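(* Every cubic graph admits a $5$-weak bisection. That is, for every cubic graph $G=(V,E)$ there is a partition of $V$ into two disjoint sets $V_1$ and $V_2$ with $|V_1|=|V_2|$ such that, for each $i\in\{1,2\}$, every connected component of the subgraph $G[V_i]$ of $G$ induced by $V_i$ is a tree on at most $3$ vertices.
   Context: Graphs are finite and simple (no loops, no parallel edges), and not assumed to be connected or bridgeless; a graph is cubic if every vertex has degree $3$. A bisection of a cubic graph $G=(V,E)$ is a partition of $V$ into two disjoint subsets $V_1,V_2$ with $|V_1|=|V_2|$. For an integer $k\ge 3$, a $k$-weak bisection of $G$ is a bisection $(V_1,V_2)$ such that every connected component of each of the two subgraphs of $G$ induced by $V_1$ and by $V_2$ is a tree on at most $k-2$ vertices. *)

(* Defs.v *)
From mathcomp Require Import all_boot.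

Set Implicit Arguments.
Unset Strict Implicit.
Unset Printing Implicit Defensive.

Record sgraph := SGraph {
  vertex :> finType;
  adj : rel vertex;
  adj_sym : symmetric adj;
  adj_irrefl : irreflexive adj
}.

Definition neighbours (G : sgraph) (x : G) : {set G} := [set y | adj x y].

Definition cubic (G : sgraph) : Prop := forall x : G, #|neighbours x| = 3.

Section Induced.
Variables (G : sgraph) (S : {set G}).

Definition induced_adj : rel {x : G | x \in S} :=
  [rel u v | adj (val u) (val v)].

Lemma induced_adj_sym : symmetric induced_adj.
Proof. by move=> u v; apply: adj_sym. Qed.

Lemma induced_adj_irrefl : irreflexive induced_adj.
Proof. by move=> u; apply: adj_irrefl. Qed.

Definition induced : sgraph := SGraph induced_adj_sym induced_adj_irrefl.

End Induced.

Definition components (G : sgraph) : {set {set G}} :=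
  equivalence_partition (connect (@adj G)) [set: G].

(* The graph without vertices is not connected, hence not a tree. *)
Definition connected (G : sgraph) : Prop :=
  0 < #|G| /\ forall x y : G, connect (@adj G) x y.

(* [ucycle] also accepts the empty sequence and the two-vertex closed walks
   x - y - x, neither of which is a cycle of a simple graph; hence the bound on
   the size. *)
Definition acyclic (G : sgraph) : Prop :=
  forall c : seq G, 2 < size c -> ~ ucycle (@adj G) c.

Definition is_tree (G : sgraph) : Prop := connected G /\ acyclic G.

(* The two sides may be empty, which only happens when [G] has no vertex. *)
Definition bisection (G : sgraph) (V1 V2 : {set G}) : Prop :=
  [/\ V1 :|: V2 = [set: G], [disjoint V1 & V2] & #|V1| = #|V2|].

(* Meaningful for 3 <= k, since the subtraction is truncated. A component of
   [induced S], as a subgraph, is the subgraph induced by its vertex set. *)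
Definition weak_bisection (k : nat) (G : sgraph) (V1 V2 : {set G}) : Prop :=
  bisection V1 V2 /\
  forall S : {set G}, S \in [:: V1; V2] ->
  forall C : {set induced S}, C \in components (induced S) ->
    is_tree (induced C) /\ #|C| <= k - 2.

(* Main.v *)
(* Cover the vertices by vertex-disjoint paths ("pieces"), with as few pieces
   as possible and then as few "bad" ones as possible: odd pieces whose ends
   are adjacent, or which consist of one vertex. List all vertices piece after
   piece and colour them by the parity of their position. As |V| is even the
   classes are balanced, and every edge of a piece is bichromatic. Since ends
   of different pieces are never adjacent, the monochromatic components are
   stars around ends of pieces, with at most two leaves, except possibly at bad
   pieces D: there the two ends and one further neighbour of each may form a
   path, or the single vertex of D may have three leaves. Exchange arguments
   show that a neighbour q, outside D, of a bad piece D splits its own piece Q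
   into two bad parts, and that Q has no other vertex attached to a bad piece.
   So two outer neighbours of D lie in different odd pieces that serve no other
   bad piece; placing these two pieces next to each other gives the two
   neighbours different colours. Chords of D are dealt with by rotating D. *)
Require Import Defs.
From Stdlib Require Import Classical.
From mathcomp Require Import all_boot zify.

Set Implicit Arguments.
Unset Strict Implicit.
Unset Printing Implicit Defensive.

(** * Minimal elements and sequences *)

Lemma ex_minimal (T : Type) (P : T -> Prop) (f : T -> nat) :
  (exists x, P x) -> exists2 x, P x & forall y, P y -> f x <= f y.
Proof.
move=> [x Px]; have [n] := ubnP (f x); elim: n x Px => // n IH x Px lt_fx.
have [[y Py lt_y]|no] := classic (exists2 y, P y & f y < f x).
  by apply: (IH y Py); apply: leq_trans lt_y _.
exists x => // y Py; rewrite leqNgt; apply/negP => lt_y.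
by apply: no; exists y.
Qed.

Lemma perm_to_rem2 (T : eqType) (p q : T) (s : seq T) :
  p \in s -> q \in s -> p != q -> exists s0, perm_eq s [:: p, q & s0].
Proof.
move=> ps qs npq; exists (rem q (rem p s)).
have qs' : q \in rem p s.
  by move: qs; rewrite (perm_mem (perm_to_rem ps)) inE eq_sym (negPf npq).
apply: (perm_trans (perm_to_rem ps)); rewrite perm_cons; exact: perm_to_rem.
Qed.

Lemma count_odd_iota n : count odd (iota 0 n) = n./2.
Proof.
elim: n => // n IH; rewrite -addn1 iotaD count_cat IH /= add0n addn0.
by rewrite addn1 /= uphalf_half addnC.
Qed.

Section CubicGraph.
Variable G : sgraph.
Hypothesis cubicG : cubic G.

Local Notation e := (@adj G).

(** * Degree counts *)

Lemma size_neighbours (x : G) s : uniq s -> all (e x) s -> size s <= 3.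
Proof.
move=> us /allP xs; rewrite -(card_uniqP us) -(cubicG x).
by apply: subset_leq_card; apply/subsetP => y /xs; rewrite inE.
Qed.

(** Handshake argument: there are [3 * #|G|] ordered adjacent pairs, and swapping the two entries
    matches those of increasing rank with the others. *)
Lemma even_card_cubic : ~~ odd #|G|.
Proof.
pose A := [set u : G * G | e u.1 u.2].
pose lt (u : G * G) := enum_rank u.1 < enum_rank u.2.
have cA : #|A| = 3 * #|G|.
  rewrite -sum1_card (eq_bigl (fun u : G * G => e u.1 u.2)); last first.
    by move=> u; rewrite inE.
  rewrite -(pair_big_dep xpredT (fun x y => e x y) (fun _ _ => 1)) /=.
  rewrite (eq_bigr (fun _ => 3)) ?sum_nat_const ?cardT //; last first.
    move=> x _; rewrite -(cubicG x) -sum1_card; apply: eq_bigl => y.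
    by rewrite inE.
  by rewrite mulnC.
have swK : involutive (fun u : G * G => (u.2, u.1)) by case.
have swap : #|A :\: [set u | lt u]| = #|A :&: [set u | lt u]|.
  rewrite -(card_imset _ (inv_inj swK)); apply: eq_card => -[x y].
  apply/imsetP/idP => [[[a b]] |].
    rewrite !inE /lt /= => /andP[nab eab] [-> ->].
    rewrite adj_sym eab ltn_neqAle leqNgt nab andbT /=.
    apply: contraTneq eab => /val_inj/enum_rank_inj ->.
    by rewrite adj_irrefl.
  rewrite !inE /lt /= => /andP[exy lxy]; exists (y, x) => //.
  by rewrite !inE /lt /= adj_sym exy -leqNgt ltnW.
have : odd (3 * #|G|) = false.
  by rewrite -cA -(cardsID [set u | lt u] A) swap addnn odd_double.
by rewrite oddM /= => ->.
Qed.

(** * Path covers and minimality *)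

Definition piece (p : seq G) := (p != [::]) && sorted e p.

Definition cover (L : seq (seq G)) :=
  all piece L && perm_eq (flatten L) (enum G).

(* An odd path that closes up into a cycle, or a single vertex: in the
   alternating colouring its two ends have the same colour although they are
   adjacent. *)
Definition bad (p : seq G) :=
  odd (size p) && ((size p == 1) || cycle e p).

Definition is_end (x : G) (p : seq G) := (x == head x p) || (x == last x p).

(** The ends of an odd piece have even index, so for such an end these are its neighbours on the
    piece that get the opposite colour. *)
Definition odd_nbrs (x : G) (p : seq G) :=
  [set z | [&& e x z, z \in p & odd (index z p)]].

Definition even_chord (p : seq G) (u : G * G) :=
  [&& is_end u.1 p, u.1 \in p, e u.1 u.2, u.2 \in p, ~~ is_end u.2 p &
      ~~ odd (index u.2 p)].

(** In an odd piece, such an end has at most one neighbour of its own colour, so it cannot be an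
    inner vertex of a monochromatic path. *)
Definition relieved (p : seq G) :=
  [exists w, [&& is_end w p, w \in p & 1 < #|odd_nbrs w p|]].

Definition troubled (p : seq G) :=
  [exists u, even_chord p u] && ~~ relieved p.

(* The second unit is what [relieve] saves by rotating a bad piece. *)
Definition weight (p : seq G) : nat := bad p * (troubled p).+1.

Definition total_weight (L : seq (seq G)) := sumn (map weight L).

Definition minimal (L : seq (seq G)) :=
  cover L /\ forall L', cover L' ->
    size L <= size L' /\ (size L' <= size L -> total_weight L <= total_weight L').

Lemma minimal_exists : exists L, minimal L.
Proof.
have [L1 cL1 min1] : exists2 L, cover L & forall L', cover L' -> size L <= size L'.
  apply: (@ex_minimal _ (fun L => cover L) size).
  exists [seq [:: x] | x <- enum G]; rewrite /cover.
  have -> : flatten [seq [:: x] | x <- enum G] = enum G.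
    by elim: (enum G) => //= x s ->.
  by rewrite perm_refl andbT; apply/allP => p /mapP[x _ ->].
have [L [cL sL] min2] : exists2 L, cover L /\ size L <= size L1 &
    forall L', cover L' /\ size L' <= size L1 -> total_weight L <= total_weight L'.
  by apply: ex_minimal; exists L1.
exists L; split=> // L' cL'; split; first exact: leq_trans sL (min1 _ cL').
by move=> h; apply: min2; split=> //; apply: leq_trans h sL.
Qed.

Lemma cover_perm L L' : perm_eq L L' -> cover L -> cover L'.
Proof.
move=> pL /andP[aL fL]; apply/andP; split; first by rewrite -(perm_all _ pL).
by rewrite -(permPl (perm_flatten pL)).
Qed.

Lemma minimal_perm L L' : perm_eq L L' -> minimal L -> minimal L'.
Proof.
move=> pL [cL mL]; split; first exact: cover_perm cL.
have -> : total_weight L' = total_weight L.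
  by apply: perm_sumn; rewrite perm_sym; apply: perm_map.
by move=> M; rewrite -(perm_size pL); apply: mL.
Qed.

(** Local form of minimality: the untouched pieces [L0] contribute equally to both covers and
    cancel. *)
Lemma exchange L ps qs L0 :
    minimal L -> perm_eq L (ps ++ L0) -> all piece qs ->
    perm_eq (flatten ps) (flatten qs) ->
  size ps <= size qs /\ (size qs <= size ps -> total_weight ps <= total_weight qs).
Proof.
move=> mL pL aq pf; have [/andP[aL fL] mn] := minimal_perm pL mL.
have cL' : cover (qs ++ L0).
  apply/andP; split; first by move: aL; rewrite !all_cat aq => /andP[].
  by rewrite -(permPr fL) !flatten_cat perm_cat2r perm_sym.
have [s1 s2] := mn _ cL'.
move: s1 s2; rewrite !size_cat /total_weight !map_cat !sumn_cat leq_add2r => s1 s2.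
by split=> // h; move: s2; rewrite !leq_add2r; apply.
Qed.

(** * Possible ends of a piece *)

Definition can_end (x : G) (p : seq G) :=
  exists2 r, sorted e (rcons r x) & perm_eq (rcons r x) p.

Lemma sorted_adj_rev p : sorted e (rev p) = sorted e p.
Proof. by rewrite rev_sorted; apply: eq_sorted => x y; rewrite adj_sym. Qed.

Lemma sorted_join p x y q :
  sorted e (rcons p x) -> sorted e (y :: q) -> e x y ->
  sorted e (rcons p x ++ y :: q).
Proof.
by move=> sp sq xy; rewrite cat_rcons sorted_cat_cons sp /= xy.
Qed.

Lemma can_end_last x p : sorted e (rcons p x) -> can_end x (rcons p x).
Proof. by move=> sp; exists p. Qed.

Lemma can_end_head x p : sorted e (x :: p) -> can_end x (x :: p).
Proof.
move=> sp; exists (rev p); rewrite -rev_cons ?sorted_adj_rev //.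
by rewrite perm_rev.
Qed.

Lemma can_end_perm x p q : perm_eq p q -> can_end x p -> can_end x q.
Proof. by move=> pq [r sr pr]; exists r => //; rewrite (permPl pr). Qed.

Lemma is_end_can x p : piece p -> x \in p -> is_end x p -> can_end x p.
Proof.
case/andP; case: p => // y p _ sp xp /orP[]/eqP /= ->.
  exact: can_end_head.
by move: sp; rewrite lastI; apply: can_end_last.
Qed.

Lemma sorted_cycle p : cycle e p -> sorted e p.
Proof. by case: p => //= x p; rewrite rcons_path => /andP[]. Qed.

(** A cycle can be opened at any of its vertices. For this reason [can_end] admits every path on the
    vertices of [p], not only [p] itself. *)
Lemma bad_can x p : bad p -> x \in p -> can_end x p.
Proof.
case/andP=> _ /orP[/eqP|cp xp].
  case: p => [|y []] // _; rewrite inE => /eqP ->.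
  by exists [::].
case/rot_to: (xp) => i q rp; apply: (@can_end_perm _ (rot i p)).
  by rewrite perm_rot.
by rewrite rp; apply: can_end_head; rewrite -rp sorted_cycle ?rot_cycle.
Qed.

(** An edge between the ends would join the two pieces into one path, giving a cover with fewer
    pieces. *)
Lemma ends_nonadj L p q x y :
    minimal L -> p \in L -> q \in L -> p != q ->
  can_end x p -> can_end y q -> ~~ e x y.
Proof.
move=> mL pL qL npq [r sr pr] [t st pt]; apply/negP => xy.
have [L0 pL0] := perm_to_rem2 pL qL npq.
have st' : sorted e (y :: rev t) by rewrite -rev_rcons sorted_adj_rev.
have [] := @exchange L [:: p; q] [:: rcons r x ++ y :: rev t] L0 mL pL0.
- by rewrite /= /piece sorted_join // andbT; case: (r).
- rewrite /= !cats0 perm_sym; apply: perm_cat => //.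
  by rewrite -rev_rcons perm_rev.
- by [].
Qed.

(** * Vertices attached to a bad piece *)

Lemma can_end_other x r : sorted e (rcons r x) ->
  can_end (head x (rcons r x)) (rcons r x).
Proof. by case: r => [|y r] /=; [exists [::] | apply: can_end_head]. Qed.

(* Otherwise replace D and Q by D ++ q :: rev A, which cannot close up, and C:
   as many pieces, but a smaller weight. *)
Lemma attach_bad L D Q x q A C :
    minimal L -> D \in L -> Q \in L -> D != Q -> bad D -> x \in D -> e x q ->
    perm_eq (A ++ q :: C) Q -> sorted e (A ++ q :: C) ->
  bad C.
Proof.
move=> mL DL QL nDQ bD xD xq pQ sQ.
have eD := bad_can bD xD.
have A0 : A <> [::].
  move=> A0; rewrite {}A0 in pQ sQ.
  suff eQ : can_end q Q by move: (ends_nonadj mL DL QL nDQ eD eQ); rewrite xq.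
  by apply: (can_end_perm pQ); apply: can_end_head.
have C0 : C <> [::].
  move=> C0; rewrite {}C0 in pQ sQ.
  suff eQ : can_end q Q by move: (ends_nonadj mL DL QL nDQ eD eQ); rewrite xq.
  by move: sQ pQ; rewrite cats1 => sQ /can_end_perm; apply; apply: can_end_last.
have eA : can_end (head q A) Q.
  apply: (can_end_perm pQ); case: A A0 sQ {pQ} => // a A _ /= sQ.
  exact: can_end_head.
case: eD => r sr pr.
have [L0 pL0] := perm_to_rem2 DL QL nDQ.
move: (sQ); rewrite sorted_cat_cons => /andP[sA sC].
have sA' : sorted e (q :: rev A) by rewrite -rev_rcons sorted_adj_rev.
set P1 := rcons r x ++ q :: rev A.
have sP1 : sorted e P1 by apply: sorted_join.
have pf : perm_eq (flatten [:: D; Q]) (flatten [:: P1; C]).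
  apply/permP => a; rewrite /P1 /= !cats0 !count_cat -(permP pr) -(permP pQ).
  by rewrite !count_cat /= count_rev -!addnA [_ + (a q + _)]addnCA.
have ap : all piece [:: P1; C].
  by rewrite /= /piece sP1 (path_sorted sC) /P1; case: (r); case: (C) C0.
have [_ h] := @exchange L [:: D; Q] [:: P1; C] L0 mL pL0 ap pf.
move: (h isT); rewrite /total_weight /=.
(* A closing edge of [P1] would join a possible end of [D] to the first vertex of [A], a possible
   end of [Q]. *)
have -> : weight P1 = 0.
  suff /negPf nb : ~~ bad P1 by rewrite /weight nb.
  apply/negP => /andP[_ /orP[]].
    by rewrite /P1 size_cat size_rcons /= addnS addSn.
  have [A' [a Aa]] : exists A' a, A = a :: A'.
    by move: A0; case: (A) => // a A' _; exists A', a.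
  have hP : P1 = head x (rcons r x) :: behead P1 by rewrite /P1; case: (r).
  rewrite hP /= rcons_path => /andP[_].
  have -> : last (head x (rcons r x)) (behead P1) = a.
    have <- : last q P1 = a by rewrite /P1 last_cat Aa rev_cons /= last_rcons.
    by rewrite hP.
  apply/negP; rewrite adj_sym; apply: (ends_nonadj mL DL QL nDQ).
    by apply: (can_end_perm pr); apply: can_end_other.
  by move: eA; rewrite Aa.
(* [D] weighs at least 1 and [P1] nothing, so [C] must have positive weight. *)
by rewrite {1}/weight bD !addn0 add0n /weight;
  case: (bad C) => //; rewrite mul0n mul1n.
Qed.

(** [attach_bad] is applied to [Q] for [C] and to the reversal of [Q] for [A]; badness is invariant
    under reversal. *)
Lemma attach_split L D Q x q :
    minimal L -> D \in L -> Q \in L -> D != Q -> bad D -> x \in D -> e x q ->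
  forall A C, Q = A ++ q :: C -> bad A /\ bad C.
Proof.
move=> mL DL QL nDQ bD xD xq A C EQ.
have [/andP[/allP aL _] _] := mL.
have /andP[_ sQ] := aL _ QL.
split; last by apply: (attach_bad mL DL QL nDQ bD xD xq (A := A)); rewrite -EQ.
have := attach_bad mL DL QL nDQ bD xD xq (A := rev C) (C := rev A).
have -> : rev C ++ q :: rev A = rev Q by rewrite EQ rev_cat rev_cons cat_rcons.
rewrite perm_rev sorted_adj_rev => /(_ (perm_refl _) sQ).
rewrite /bad size_rev => /andP[-> /=]; case: (_ == 1) => //=.
have -> : cycle e (rev A) = cycle e A.
  by rewrite rev_cycle; apply: eq_cycle => y z; rewrite adj_sym.
by [].
Qed.

(* Since A ++ q1 :: B and B ++ q2 :: C close up, D2, q2 :: C, B and rcons A q1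
   would chain into a single path. *)
Lemma attach_two L D1 D2 Q x1 x2 q1 q2 A B C :
    minimal L -> D1 \in L -> D2 \in L -> Q \in L -> D1 != Q -> D2 != Q ->
    bad D1 -> bad D2 -> x1 \in D1 -> x2 \in D2 -> e x1 q1 -> e x2 q2 ->
  Q <> A ++ q1 :: B ++ q2 :: C.
Proof.
move=> mL D1L D2L QL n1 n2 b1 b2 xD1 xD2 xq1 xq2 EQ.
have [bA bBC] := attach_split mL D1L QL n1 b1 xD1 xq1 EQ.
have EQ2 : Q = (A ++ q1 :: B) ++ q2 :: C by rewrite -catA.
have [bAB bC] := attach_split mL D2L QL n2 b2 xD2 xq2 EQ2.
have oA : odd (size A) by case/andP: bA.
have oC : odd (size C) by case/andP: bC.
(* Odd lengths make [A] and [B] nonempty, so [A ++ q1 :: B] and [B ++ q2 :: C] have more than one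
   vertex and, being bad, must close up. *)
have oB : odd (size B).
  by case/andP: bBC; rewrite size_cat addnS /= oddD oC addbT negbK.
have [/andP[/allP aL _] _] := mL.
have /andP[_ sQ] := aL _ QL.
have {bBC} cBC : cycle e (B ++ q2 :: C).
  by case/andP: bBC => _ /orP[] //; rewrite size_cat /= addnS; case: (B) oB.
have {bAB} cAB : cycle e (A ++ q1 :: B).
  by case/andP: bAB => _ /orP[] //; rewrite size_cat /= addnS; case: (A) oA.
case: A oA {bA} EQ EQ2 cAB => // a A oA EQ EQ2 cAB.
case: B oB EQ EQ2 cAB cBC => // b B oB EQ EQ2 cAB cBC.
have [r sr pr] := bad_can b2 xD2.
have [L0 pL0] := perm_to_rem2 D2L QL n2.
move: sQ; rewrite EQ2 sorted_cat_cons => /andP[s1 s2].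
have [s3 s4] : sorted e (rcons (a :: A) q1) /\ sorted e (b :: B).
  move: s1; rewrite rcons_cat rcons_cons sorted_cat_cons => /andP[-> /=].
  by rewrite rcons_path => /and3P[].
have l1 : e (last q2 C) b.
  by move: cBC; rewrite /= rcons_path last_cat /= => /andP[].
have l2 : e (last b B) a.
  by move: cAB; rewrite /= rcons_path last_cat /= => /andP[].
have s5 : sorted e ((q2 :: C) ++ (b :: B) ++ rcons (a :: A) q1).
  move: s2 s4 s3 => /= s2 s4 s3.
  by rewrite cat_path s2 /= l1 cat_path s4 /= l2 s3.
have [] := @exchange L [:: D2; Q]
  [:: rcons r x2 ++ (q2 :: C) ++ (b :: B) ++ rcons (a :: A) q1] L0 mL pL0.
- rewrite /= andbT /piece; apply/andP; split; first by case: (r).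
  exact: sorted_join.
- apply/permP => z; rewrite EQ /= !cats0 !count_cat -(permP pr).
  rewrite /= !count_cat /= -!cats1 !count_cat /= !count_cat /=; clear; lia.
- by [].
Qed.

(** * Disjointness of pieces and uniqueness of attachments *)

Lemma cover_uniq L : cover L -> uniq (flatten L).
Proof. by case/andP=> _ pL; rewrite (perm_uniq pL) enum_uniq. Qed.

Lemma cover_piece_of L x : cover L -> exists2 p, p \in L & x \in p.
Proof.
by case/andP=> _ pL; apply/flattenP; rewrite (perm_mem pL) mem_enum.
Qed.

Lemma cover_disjoint L p q x :
  cover L -> p \in L -> q \in L -> x \in p -> x \in q -> p = q.
Proof.
move=> cL pL qL xp xq; apply/eqP/negPn/negP => npq.
have [L0 /cover_perm/(_ cL)/cover_uniq] := perm_to_rem2 pL qL npq.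
rewrite /= cat_uniq => /and3P[_ /hasPn/(_ x)]; rewrite mem_cat xq => /(_ isT).
by rewrite xp.
Qed.

Lemma cover_uniq_piece L p : cover L -> p \in L -> uniq p.
Proof.
move=> cL pL; move: (cover_uniq cL).
rewrite (perm_uniq (perm_flatten (perm_to_rem pL))).
by rewrite /= cat_uniq => /and3P[].
Qed.

Lemma cover_uniq_pieces L : cover L -> uniq L.
Proof.
move=> cL; have := cover_uniq cL; have [/allP aL _] := andP cL.
elim: {cL} L aL => //= p L IH aL; rewrite cat_uniq => /and3P[_ /hasPn dpL uL].
rewrite IH ?andbT // => [|q qL]; last by apply: aL; rewrite inE qL orbT.
apply/negP => pL; have /andP[p0 _] := aL p (mem_head _ _).
case: p p0 dpL pL {aL} => // x p _ dpL pL.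
have /dpL/negP[] : x \in flatten L.
  by apply/flattenP; exists (x :: p); rewrite ?mem_head.
by rewrite /= mem_head.
Qed.

Lemma outer_split L D Q x a :
    minimal L -> D \in L -> Q \in L -> bad D -> x \in D -> a \notin D ->
    e x a -> a \in Q ->
  D != Q /\ exists A C, [/\ Q = A ++ a :: C, bad A & bad C].
Proof.
move=> mL DL QL bD xD aD xa aQ.
have nDQ : D != Q by apply: contraNneq aD => ->.
split=> //; case/splitPr: (aQ) QL nDQ => A C QL nDQ; exists A, C.
by have [] := attach_split mL DL QL nDQ bD xD xa erefl.
Qed.

(** Two attached vertices on [Q] are excluded by [attach_two], in either order. One vertex attached
    from two sides would have degree 4: it has two neighbours along [Q], both parts of [Q] being
    nonempty, besides [x1] and [x2]. The case [D1 = D2] is included. *)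
Lemma attach_unique L D1 D2 Q x1 x2 a1 a2 :
    minimal L -> D1 \in L -> D2 \in L -> Q \in L -> bad D1 -> bad D2 ->
    x1 \in D1 -> x2 \in D2 -> a1 \notin D1 -> a2 \notin D2 ->
    e x1 a1 -> e x2 a2 -> a1 \in Q -> a2 \in Q ->
  a1 = a2 /\ x1 = x2.
Proof.
move=> mL D1L D2L QL b1 b2 xD1 xD2 aD1 aD2 xa1 xa2 aQ1 aQ2.
have cL : cover L by case: mL.
have [n1 [A [C [EQ bA bC]]]] := outer_split mL D1L QL b1 xD1 aD1 xa1 aQ1.
have [n2 _] := outer_split mL D2L QL b2 xD2 aD2 xa2 aQ2.
have Ea : a1 = a2.
  move: (aQ2); rewrite EQ mem_cat inE => /or3P[aA|/eqP //|aC].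
    case/splitPr: aA EQ {bA} => A1 A2 EQ; rewrite -catA /= in EQ.
    by case: (attach_two mL D2L D1L QL n2 n1 b2 b1 xD2 xD1 xa2 xa1 EQ).
  case/splitPr: aC EQ {bC} => A1 A2 EQ.
  by case: (attach_two mL D1L D2L QL n1 n2 b1 b2 xD1 xD2 xa1 xa2 EQ).
split=> //; apply/eqP/negPn/negP => nx; rewrite -{}Ea {aQ2 aD2} in xa2.
have /andP[/allP/(_ _ QL)/andP[_ sQ] _] := cL.
have uQ := cover_uniq_piece cL QL.
have xQ1 : x1 \notin Q.
  by apply/negP => xQ; rewrite (cover_disjoint cL D1L QL xD1 xQ) eqxx in n1.
have xQ2 : x2 \notin Q.
  by apply/negP => xQ; rewrite (cover_disjoint cL D2L QL xD2 xQ) eqxx in n2.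
case/lastP: A bA EQ => // A y _ EQ; case: C bC EQ => // z C _ EQ.
rewrite {}EQ cat_rcons in sQ uQ xQ1 xQ2.
suff: size [:: y; z; x1; x2] <= 3 by [].
apply: (@size_neighbours a1) => /=.
  move: uQ xQ1 xQ2; rewrite cat_uniq /= !mem_cat !inE !negb_or nx !andbT.
  case/and3P=> _ _ /and3P[/and3P[_ -> _] _ _].
  rewrite /= ![_ == x1]eq_sym ![_ == x2]eq_sym.
  by case/and5P=> _ -> _ -> _ /and5P[_ -> _ -> _].
move: sQ; rewrite sorted_cat_cons /= => /and4P[_ ya az _].
by rewrite adj_sym ya az adj_sym xa1 adj_sym xa2.
Qed.

(** * The colouring and its balance at bad pieces *)

Definition outer_pair (D : seq G) (u : G * G) :=
  [&& u.1 \notin D, u.2 \notin D, u.1 != u.2, e (head u.1 D) u.1 &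
      e (last u.2 D) u.2].

(* Consecutive vertices of a piece get opposite colours, and the two colour
   classes have the same size whatever the order of the pieces, as #|G| is
   even. *)
Definition color (L : seq (seq G)) (x : G) := odd (index x (flatten L)).

Lemma color_cat L1 p L2 x :
    uniq (flatten (L1 ++ p :: L2)) -> x \in p ->
  color (L1 ++ p :: L2) x = odd (size (flatten L1)) (+) odd (index x p).
Proof.
rewrite /color flatten_cat /= cat_uniq => /and3P[_ /hasPn dL _] xp.
rewrite index_cat (negPf (dL x _)) ?mem_cat ?xp //.
by rewrite index_cat xp oddD.
Qed.

Lemma color_in L p x y :
    cover L -> p \in L -> x \in p -> y \in p ->
  (color L x == color L y) = (odd (index x p) == odd (index y p)).
Proof.
move=> /cover_uniq uL pL xp yp; case/splitPr: pL uL => L1 L2 uL.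
by rewrite !color_cat //; do 3!case: odd.
Qed.

Lemma index_split (T : eqType) (A C : seq T) x :
  uniq (A ++ x :: C) -> index x (A ++ x :: C) = size A.
Proof.
rewrite cat_uniq => /and3P[_ /hasPn/(_ x (mem_head _ _)) /= xA _].
by rewrite index_cat (negPf xA) /= eqxx addn0.
Qed.

Lemma color_consec L A y z C :
  cover L -> A ++ y :: z :: C \in L -> color L y != color L z.
Proof.
move=> cL pL; have uQ := cover_uniq_piece cL pL.
rewrite (color_in cL pL) ?mem_cat ?inE ?eqxx ?orbT // index_split //.
move: uQ; rewrite -cat_rcons => uQ; rewrite index_split // size_rcons /=.
by case: odd.
Qed.

(** One chosen pair suffices: an end of a longer bad piece has at most one neighbour outside it, and
    a one-vertex piece only requires two neighbours of different colours. *)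
Definition pair_of (D : seq G) := [pick u | outer_pair D u].

Definition balanced (L : seq (seq G)) :=
  forall D u, D \in L -> bad D -> pair_of D = Some u ->
  color L u.1 != color L u.2.

(* Permute the pieces so that, for every bad D, the two pieces containing the
   vertices of [pair_of D] are consecutive: both have odd size and both
   vertices have odd index in them, so the parities of their global indices
   differ. These pairs of pieces do not overlap, by [attach_unique]. *)
Lemma minimal_balanced : exists2 L, minimal L & balanced L.
Proof.
have [L0 mL0] := minimal_exists; have cL0 : cover L0 by case: mL0.
pose host x := nth [::] L0 (find (fun p : seq G => x \in p) L0).
have hostP x : host x \in L0 /\ x \in host x.
  have hx : has (fun p : seq G => x \in p) L0.
    by have [p pL xp] := cover_piece_of x cL0; apply/hasP; exists p.
  by split; [apply: mem_nth; rewrite -has_find | apply: (nth_find [::] hx)].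
pose f D := if pair_of D is Some u then [:: host u.1; host u.2] else [::].
have pairP D u : bad D -> pair_of D = Some u -> exists x y,
    [/\ x \in D, y \in D, u.1 \notin D, u.2 \notin D &
        [/\ e x u.1, e y u.2 & u.1 != u.2]].
  rewrite /pair_of => bD; case: pickP => // v /and5P[v1 v2 nv e1 e2] [<-].
  exists (head v.1 D), (last v.2 D); case: D bD v1 v2 e1 e2 => // d D _ v1 v2 e1 e2.
  by rewrite mem_head /= mem_last.
have fP D Q : bad D -> Q \in f D ->
    exists x a, [/\ x \in D, a \notin D, e x a, a \in Q & Q \in L0].
  rewrite /f; case E: (pair_of D) => [u|] // bD.
  have [x [y [xD yD u1 u2 [e1 e2 _]]]] := pairP D u bD E.
  by rewrite !inE => /orP[]/eqP->; [exists x, u.1 | exists y, u.2];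
    case: (hostP u.1) (hostP u.2) => ? ? [].
pose T := [seq D <- L0 | bad D].
have TP D : D \in T -> bad D /\ D \in L0 by rewrite mem_filter => /andP.
have uT : uniq T by rewrite filter_uniq // cover_uniq_pieces.
pose S := flatten (map f T).
have sS : {subset S <= L0}.
  move=> Q /flattenP[_ /mapP[D /TP[bD DL] ->]] /(fP _ _ bD).
  by case=> x [a []].
(* A repeated entry would be a piece serving twice. By [attach_unique], within one pair this
   identifies the two vertices of the pair, and between two bad pieces it gives them a common
   vertex. *)
have uS : uniq S.
  rewrite /S; elim: (T) TP uT => //= D T' IH TP' /andP[DT uT'].
  have [bD DL] := TP' D (mem_head _ _).
  have TP2 D' : D' \in T' -> bad D' /\ D' \in L0.
    by move=> D'T; apply: TP'; rewrite inE D'T orbT.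
  rewrite cat_uniq IH // andbT; apply/andP; split.
    rewrite /f; case E: (pair_of D) => [u|] //=; rewrite inE andbT.
    have [x [y [xD yD u1 u2 [e1 e2 nu]]]] := pairP D u bD E.
    have [h1 m1] := hostP u.1; have [h2 m2] := hostP u.2.
    apply: contra nu => /eqP h; rewrite h in m1.
    by have [->] := attach_unique mL0 DL DL h2 bD bD xD yD u1 u2 e1 e2 m1 m2.
  apply/hasPn => Q /flattenP[_ /mapP[D' D'T ->]].
  have [bD' DL'] := TP2 D' D'T.
  case/(fP _ _ bD') => x' [a' [xD' aD' xa' aQ' QL]].
  apply/negP => /= /(fP _ _ bD)[x [a [xD aD xa aQ _]]].
  have [_ Ex] := attach_unique mL0 DL DL' QL bD bD' xD xD' aD aD' xa xa' aQ aQ'.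
  by rewrite (cover_disjoint cL0 DL DL' xD) ?D'T // Ex in DT.
pose L := S ++ [seq p <- L0 | p \notin S].
have pL : perm_eq L0 L.
  apply: uniq_perm; first exact: cover_uniq_pieces.
    rewrite cat_uniq uS filter_uniq ?cover_uniq_pieces // andbT.
    by apply/hasPn => p; rewrite mem_filter => /andP[].
  move=> p; rewrite mem_cat mem_filter; case: (boolP (p \in S)) => //=.
  by move/sS->.
have mL := minimal_perm pL mL0; exists L => // D u; rewrite -(perm_mem pL).
move=> DL bD E; have uL : uniq (flatten L) by apply: cover_uniq; case: mL.
have [x [y [xD yD u1 u2 [e1 e2 nu]]]] := pairP D u bD E.
have [h1 m1] := hostP u.1; have [h2 m2] := hostP u.2.
have [_ [A1 [C1 [Q1 /andP[oA1 _] /andP[oC1 _]]]]] :=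
  outer_split mL0 DL h1 bD xD u1 e1 m1.
have [_ [A2 [C2 [Q2 /andP[oA2 _] /andP[oC2 _]]]]] :=
  outer_split mL0 DL h2 bD yD u2 e2 m2.
have DT : D \in T by rewrite mem_filter bD.
have [S1 [S2 ES]] : exists S1 S2, S = S1 ++ host u.1 :: host u.2 :: S2.
  rewrite /S; case/splitPr: DT => T1 T2; rewrite map_cat flatten_cat /= {2}/f E /=.
  by exists (flatten (map f T1)), (flatten (map f T2)).
move: uL; rewrite /L ES -catA !cat_cons => uL.
rewrite color_cat // -cat_rcons color_cat // ?cat_rcons //.
rewrite -cats1 flatten_cat size_cat /= cats0.
have uh1 := cover_uniq_piece cL0 h1; have uh2 := cover_uniq_piece cL0 h2.
rewrite Q1 in uh1 *; rewrite Q2 in uh2 *.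
rewrite !index_split // size_cat /= !oddD /= oA1 oA2 oC1.
by case: odd.
Qed.

(** * Rotating bad pieces *)

(* Opening the cycle at the other side of d changes the parity of the index of
   the other end of the chord. *)
Lemma relieve p u :
    uniq p -> bad p -> even_chord p u ->
  exists p', [/\ perm_eq p p', sorted e p', bad p' & relieved p'].
Proof.
case: u => d z up bp /and5P[/= dend dp dz zp /andP[nz oz]].
have np1 : size p != 1.
  case: p {bp up nz oz} dp zp dend => [|y []] //; rewrite !inE => /eqP Ed /eqP Ez.
  by rewrite Ed Ez adj_irrefl in dz.
have cp : cycle e p by case/andP: bp => _; rewrite (negPf np1).
have osp : odd (size p) by case/andP: bp.
have rel p' l : is_end d p' -> d \in p' -> e d l -> z \in p' -> l \in p' ->
    odd (index z p') -> odd (index l p') -> z != l -> relieved p'.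
  move=> de dp' dl zp' lp' oz' ol' zl; apply/existsP; exists d; rewrite de dp' /=.
  by apply/card_gt1P; exists z, l; split=> //; rewrite inE ?dz ?dl ?zp' ?lp'.
(* If [d] comes first, moving it to the back lowers the index of [z] by one and leaves the former
   last vertex [l] at the odd index [size t]. *)
case/orP: dend => /eqP Ed.
  have [t Ep] : exists t, p = d :: t.
    by case: (p) dp Ed => // x t _ /= ->; exists t.
  case/lastP: t Ep => [|t l] Ep; first by rewrite Ep in np1.
  have zd : z != d by apply: contraTneq dz => ->; rewrite adj_irrefl.
  have zl : z != l by move: nz; rewrite Ep /is_end /= last_rcons => /norP[].
  have cp' : cycle e (rcons (rcons t l) d) by rewrite -rot1_cons rot_cycle -Ep.
  have ztl : z \in rcons t l by move: zp; rewrite Ep inE (negPf zd).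
  have utl : uniq (rcons t l) by move: up; rewrite Ep => /andP[].
  have ot : odd (size t) by move: osp; rewrite Ep /= size_rcons /= negbK.
  exists (rcons (rcons t l) d); split.
  - by rewrite Ep perm_sym perm_rcons.
  - exact: sorted_cycle.
  - by rewrite /bad cp' orbT andbT !size_rcons /= negbK.
  - apply: (rel _ l) => //; rewrite ?mem_rcons ?inE ?mem_rcons ?inE ?eqxx ?orbT //.
    + by rewrite /is_end last_rcons eqxx orbT.
    + by move: cp; rewrite Ep /= rcons_path last_rcons adj_sym => /andP[].
    + by move: ztl; rewrite mem_rcons inE => ->; rewrite orbT.
    + rewrite -cats1 index_cat ztl; move: oz; rewrite Ep /= eq_sym (negPf zd) /=.
      by rewrite negbK.
    + rewrite -cats1 index_cat mem_rcons mem_head -cats1 index_split //.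
      by rewrite cats1.
(* If [d] comes last, moving it to the front raises the index of [z] by one and puts [h] at index
   1. *)
have [t Ep] : exists t, p = rcons t d.
  by case/lastP: (p) dp Ed => // t x _; rewrite last_rcons => ->; exists t.
case: t Ep => [|h t] Ep; first by rewrite Ep in np1.
have zd : z != d by apply: contraTneq dz => ->; rewrite adj_irrefl.
have zh : z != h by move: nz; rewrite Ep /is_end /= => /norP[].
have cp' : cycle e (d :: h :: t) by rewrite -(rot_cycle 1) rot1_cons -Ep.
have ztl : z \in h :: t by move: zp; rewrite Ep mem_rcons inE (negPf zd).
have dh : d != h.
  by move: up; rewrite Ep /= mem_rcons inE negb_or eq_sym => /andP[/andP[]].
exists (d :: h :: t); split.
- by rewrite Ep perm_rcons.
- exact: sorted_cycle.
- by rewrite /bad cp' orbT andbT; move: osp; rewrite Ep size_rcons.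
- apply: (rel _ h) => //; rewrite ?inE ?eqxx ?orbT //.
  + by rewrite /is_end eqxx.
  + by case/andP: cp'.
  + by rewrite -in_cons ztl orbT.
  + move: oz; rewrite Ep -cats1 index_cat ztl.
    by rewrite [index z (d :: _)]/= eq_sym (negPf zd).
  + by rewrite /= (negPf dh) eqxx.
Qed.

(** The rotation from [relieve] would lower the weight of the piece from 2 to 1. *)
Lemma minimal_untroubled L p : minimal L -> p \in L -> bad p -> ~~ troubled p.
Proof.
move=> mL pL bp; apply/negP => tp.
have cL : cover L by case: mL.
have /andP[/existsP[u up] _] := tp.
have [p' [pp sp bp' rp]] := relieve (cover_uniq_piece cL pL) bp up.
have [] := @exchange L [:: p] [:: p'] (rem p L) mL (perm_to_rem pL).
- by rewrite /= /piece sp !andbT; case: (p') bp'.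
- by rewrite /= !cats0.
- move=> _ /(_ isT).
  by rewrite /total_weight /= /weight bp bp' tp /troubled rp andbF.
Qed.

(** * Monochromatic neighbours and paths *)

Lemma two_and_two L b y z s t :
    e b y -> e b z -> e b s -> e b t -> y != z -> s != t ->
    color L y != color L b -> color L z != color L b ->
    color L s = color L b -> color L t = color L b -> False.
Proof.
move=> by_ bz bs bt nyz nst cy cz cs ct.
suff: size [:: y; z; s; t] <= 3 by [].
apply: (@size_neighbours b); last by rewrite /= by_ bz bs bt.
have neq v w : color L v != color L b -> color L w = color L b -> v != w.
  by move=> cv cw; apply: contraNneq cv => ->; rewrite cw.
by rewrite /= !inE !negb_or nyz nst !neq.
Qed.

(** An inner vertex of a piece has two neighbours of the other colour along it, which leaves at most
    one of its own. *)
Lemma mono_end L p b s t :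
    cover L -> p \in L -> b \in p -> e b s -> e b t -> s != t ->
    color L s = color L b -> color L t = color L b ->
  is_end b p.
Proof.
move=> cL pL bp bs bt nst cs ct; case/splitPr: bp pL => A C pL.
have [/allP/(_ _ pL)/andP[_ sp] _] := andP cL.
case/lastP: A => [|A y] in pL sp *; first by rewrite /is_end /= eqxx.
case: C => [|z C] in pL sp *; first by rewrite /is_end cats1 last_rcons eqxx orbT.
rewrite cat_rcons in pL sp.
move: sp; rewrite sorted_cat_cons /= => /and4P[_ yb bz _].
have cyb := color_consec cL pL.
have cbz : color L b != color L z.
  by apply: (@color_consec L (rcons A y) b z C) => //; rewrite cat_rcons.
have up := cover_uniq_piece cL pL.
have nyz : y != z.
  by move: up; rewrite cat_uniq /= !inE !negb_or => /and3P[_ _ /andP[/and3P[_ ->]]].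
by case: (@two_and_two L b y z s t) => //; [rewrite adj_sym | rewrite eq_sym].
Qed.

(** A neighbour along the piece will do. If [x] is a piece by itself, that piece is bad, and
    [balanced] gives [x] two neighbours of different colours. *)
Lemma colorful_neighbour L x :
    minimal L -> balanced L ->
  exists2 y, e x y & color L y != color L x.
Proof.
move=> mL pairL; have cL : cover L by case: mL.
have [p pL xp] := cover_piece_of x cL; case/splitPr: xp pL => A C pL.
have [/allP/(_ _ pL)/andP[_ sp] _] := andP cL.
case: C => [|z C] in pL sp *; last first.
  move: sp; rewrite sorted_cat_cons /= => /and3P[_ xz _]; exists z => //.
  by rewrite eq_sym (color_consec cL pL).
case/lastP: A => [|A y] in pL sp *; last first.
  rewrite cat_rcons in pL sp; move: sp; rewrite sorted_cat_cons /= => /and3P[_ yx _].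
  by exists y; [rewrite adj_sym | apply: (color_consec cL pL)].
have [a [b [ax bx nab]]] : exists a b,
    [/\ a \in neighbours x, b \in neighbours x & a != b].
  by apply/card_gt1P; rewrite cubicG.
rewrite !inE in ax bx.
have nb y : e x y -> y \notin [:: x].
  by move=> xy; rewrite inE; apply: contraTneq xy => ->; rewrite adj_irrefl.
case E: (pair_of [:: x]) => [u|]; last first.
  move: E; rewrite /pair_of; case: pickP => // /(_ (a, b)).
  by rewrite /outer_pair /= ax bx nab !nb.
have := pairL _ _ pL isT E; move: E; rewrite /pair_of.
case: pickP => // v /and5P[_ _ _ /= xv1 xv2] [<-] nc.
case: (eqVneq (color L v.1) (color L x)) => [E|]; last by exists v.1.
by exists v.2; rewrite // -E eq_sym.
Qed.

(** Equal colours make the piece odd and the edge between its ends makes it bad, hence untroubled.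
    Then [b'] and [c'] turn out to be the chosen outer pair, which is not monochromatic. *)
Lemma no_mono_link L p b c b' c' :
    minimal L -> balanced L ->
    b :: rcons p c \in L -> e b c -> e b b' -> e c c' -> b' != c -> c' != b ->
    color L c = color L b -> color L b' = color L b -> color L c' = color L b ->
  False.
Proof.
move=> mL pairL; set P := b :: rcons p c => PL bc bb' cc' nb nc Ec Eb' Ec'.
have cL : cover L by case: mL.
have [/allP/(_ _ PL)/andP[_ sP] _] := andP cL.
have uP := cover_uniq_piece cL PL.
have bP : b \in P by rewrite mem_head.
have cP : c \in P by rewrite inE mem_rcons mem_head orbT.
have hP x : head x P = b by [].
have lP x : last x P = c by rewrite /= last_rcons.
have iP : index c P = (size p).+1.
  by have := @index_split _ (b :: p) [::] c; rewrite /= cats1; apply.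
have op : odd (size p).
  move/eqP: Ec; rewrite (color_in cL PL) // iP /= eqxx /=.
  by case: odd.
have bad_P : bad P.
  rewrite /bad /= size_rcons /= op /=.
  by rewrite rcons_path -[path _ _ _]/(sorted e P) sP last_rcons adj_sym.
have Ew w x : is_end w P -> w \in P -> x \in P ->
    (color L x == color L w) = ~~ odd (index x P).
  move=> we wP xP; rewrite (color_in cL PL) //.
  have -> : odd (index w P) = false.
    case/orP: we => /eqP ->; first by rewrite /= eqxx.
    by rewrite lP iP /= op.
  by case: odd.
have := minimal_untroubled mL PL bad_P.
(* If [P] is relieved, some end has two neighbours of each colour. Otherwise there is no even chord,
   so [b'] and [c'] lie outside [P]. *)
rewrite /troubled negb_and => /orP[nch|]; last first.
  rewrite negbK => /existsP[w /and3P[we wP /card_gt1P[y [z []]]]].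
  rewrite !inE => /and3P[wy yP oy] /and3P[wz zP oz] nyz.
  have cy : color L y != color L w by rewrite Ew // oy.
  have cz : color L z != color L w by rewrite Ew // oz.
  case/orP: (we); rewrite ?hP ?lP => /eqP Ewb; subst w.
    by apply: (@two_and_two L b y z b' c).
  by apply: (@two_and_two L c y z b c') => //; rewrite 1?adj_sym ?Ec // eq_sym.
have out w w' : is_end w P -> w \in P -> e w w' -> ~~ is_end w' P ->
    color L w' = color L w -> w' \notin P.
  move=> we wP ww nw Ecw; apply/negP => wP'.
  case/existsP: nch; exists (w, w'); rewrite /even_chord /= we wP ww wP' nw.
  by rewrite -(Ew w) // Ecw eqxx.
have bE : is_end b P by rewrite /is_end hP eqxx.
have cE : is_end c P by rewrite /is_end lP eqxx orbT.
have b'P : b' \notin P.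
  apply: (out b) => //; rewrite /is_end hP lP negb_or nb andbT.
  by apply: contraTneq bb' => ->; rewrite adj_irrefl.
have c'P : c' \notin P.
  apply: (out c) => //; last by rewrite Ec.
  rewrite /is_end hP lP negb_or nc /=.
  by apply: contraTneq cc' => ->; rewrite adj_irrefl.
have nbc : b != c by apply: contraTneq bc => ->; rewrite adj_irrefl.
have nb'c' : b' != c'.
  apply/eqP => E; rewrite -E in cc' c'P.
  have [Q QL bQ] := cover_piece_of b' cL.
  have [_ /eqP] := attach_unique mL PL PL QL bad_P bad_P bP cP b'P b'P bb' cc' bQ bQ.
  exact/negP.
have [q [h [l [Eh El]]]] : exists q h l, p = h :: q /\ exists q', p = rcons q' l.
  case: (p) op => // h q _; exists q, h, (last h q); split=> //.
  by exists (belast h q); rewrite -lastI.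
have eh : e b h by move: sP; rewrite /P Eh => /= /andP[].
case: El => q' El.
have el : e c l.
  by move: sP; rewrite /P El /= rcons_path last_rcons => /andP[_]; rewrite adj_sym.
have hp : h \in p by rewrite Eh mem_head.
have lp : l \in p by rewrite El mem_rcons mem_head.
(* Each end has two neighbours in [P], the other end and the next vertex of the path, so its outer
   neighbour is determined. *)
have third w o k x y : e w o -> e w k -> e w x -> e w y -> o \in P -> k \in P ->
    x \notin P -> y \notin P -> o != k -> x = y.
  move=> wo wk wx wy oP kP xP yP ok; apply/eqP/negPn/negP => nxy.
  suff: size [:: o; k; x; y] <= 3 by [].
  apply: (@size_neighbours w); last by rewrite /= wo wk wx wy.
  rewrite /= !inE !negb_or nxy ok /= !andbT.
  by apply/andP; split; apply/andP; split;
    do [apply: contraNneq xP => <- // | apply: contraNneq yP => <- //].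
have hP' : h \in P by rewrite inE mem_rcons inE hp !orbT.
have lP' : l \in P by rewrite inE mem_rcons inE lp !orbT.
move: uP; rewrite /P /= mem_rcons inE rcons_uniq negb_or.
case/andP=> /andP[_ bp] /andP[cp _].
have hc : h != c by apply: contraNneq cp => <-.
have lb : l != b by apply: contraNneq bp => <-.
case E: (pair_of P) => [u|]; last first.
  move: E; rewrite /pair_of; case: pickP => // /(_ (b', c')).
  by rewrite /outer_pair lP hP /= b'P c'P nb'c' bb' cc'.
have := pairL _ _ PL bad_P E; move: E; rewrite /pair_of.
case: pickP => // v /and5P[v1 v2 _]; rewrite hP lP => bv1 cv2 [<-].
rewrite -(third b h c b' v.1) // -(third c l b c' v.2) // 1?adj_sym //.
by rewrite Eb' Ec' eqxx.
Qed.

(** By [mono_end], [b] and [c] are ends; being adjacent, they are the two ends of one piece. As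
    [b' = c'] is allowed, triangles are covered too. *)
Lemma mono_path_free L b c b' c' :
    minimal L -> balanced L ->
    e b c -> e b b' -> e c c' -> b' != c -> c' != b ->
    color L c = color L b -> color L b' = color L b -> color L c' = color L b ->
  False.
Proof.
move=> mL pairL bc bb' cc' nb nc Ec Eb' Ec'.
have cL : cover L by case: mL.
have [p pL bp] := cover_piece_of b cL; have [q qL cq] := cover_piece_of c cL.
have cb : e c b by rewrite adj_sym.
have be : is_end b p by apply: (mono_end cL pL bp bb' bc).
have ce : is_end c q by apply: (mono_end cL qL cq cc' cb); rewrite ?Ec.
have [/allP aL _] := andP cL.
have Epq : p = q.
  apply/eqP/negPn/negP => npq; apply/negP: bc.
  by apply: (ends_nonadj mL pL qL npq); apply: is_end_can => //; apply: aL.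
have nbc : b != c by apply: contraTneq bc => ->; rewrite adj_irrefl.
rewrite -{}Epq {qL q} in cq ce.
case: p pL bp be cq ce => // x p pL bp be cq ce.
case/lastP: p pL bp be cq ce => [|p y] pL bp be cq ce.
  by move: bp cq nbc; rewrite !inE => /eqP -> /eqP ->; rewrite eqxx.
move: be ce; rewrite /is_end /= last_rcons.
case/orP=> /eqP Eb /orP[] /eqP Ex; subst b c; rewrite ?eqxx // in nbc.
  exact: (no_mono_link mL pairL pL bc bb' cc').
by apply: (no_mono_link mL pairL pL cb cc' bb'); rewrite ?Ec.
Qed.

(** The indices in [flatten L] run from 0 to [#|G| - 1], and [#|G|] is even. *)
Lemma card_color L :
  cover L -> #|[set x | color L x]| = #|[set x | ~~ color L x]|.
Proof.
move=> cL; have uL := cover_uniq cL; have [_ pL] := andP cL.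
have index_iota s : uniq s -> [seq index x s | x : G <- s] = iota 0 (size s).
  move=> us; apply: (@eq_from_nth _ 0); rewrite ?size_map ?size_iota // => i lt_i.
  case: s us lt_i => // x0 s us lt_i.
  by rewrite (nth_map x0) // index_uniq // nth_iota.
have sL : size (flatten L) = #|G| by rewrite (perm_size pL) -cardT.
have c1 : #|[set x | color L x]| = #|G|./2.
  rewrite cardsE cardE size_filter /= -enumT -(permP pL).
  rewrite -sL -count_odd_iota -index_iota // count_map.
  by apply: eq_count => x.
have -> : [set x | ~~ color L x] = ~: [set x | color L x].
  by apply/setP => x; rewrite !inE.
apply/eqP; rewrite -(eqn_add2l #|[set x | color L x]|) cardsC c1 addnn.
by rewrite -{2}(odd_double_half #|G|) (negPf even_card_cubic).
Qed.

End CubicGraph.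

(** * Small components and the bisection *)

(** Without triangles and paths on four vertices, every component is a star. *)
Lemma components_tree (H : sgraph) :
    (forall x : H, #|neighbours x| <= 2) ->
    (forall b c b' c' : H, adj b c -> adj b b' -> adj c c' ->
       b' != c -> c' != b -> False) ->
  forall C, C \in components H -> is_tree (induced C) /\ #|C| <= 3.
Proof.
move=> deg2 nolink _ /imsetP[x _ ->]; set C := [set y in _ | _].
have csym : connect_sym (@adj H) by apply: sym_connect_sym; apply: adj_sym.
(* The centre [y] is the middle of a path [x], [z], [w] if there is one, and [x] otherwise. *)
have [y xy ystar] : exists2 y, (x == y) || adj y x &
    forall z w, adj y z -> adj z w -> w = y.
  case: (pickP (fun u : H * H => [&& adj x u.1, adj u.1 u.2 & u.2 != x])).
    move=> [z w] /and3P[/= xz zw wx]; exists z; first by rewrite adj_sym xz orbT.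
    move=> z' w' zz' zw'; apply/eqP/negPn/negP => nw.
    case: (eqVneq z' x) => [E|nz]; last first.
      by apply: (nolink z z' x w'); rewrite // 1?adj_sym // eq_sym.
    by apply: (nolink z z' w w'); rewrite // E.
  move=> none; exists x; rewrite ?eqxx // => z w xz zw.
  by apply/eqP; have := none (z, w); rewrite /= xz zw /= => /negbFE.
have yC : y \in C.
  rewrite !inE /=; case/orP: xy => [/eqP->|]; first exact: connect0.
  by rewrite adj_sym => /connect1.
have CK z : z \in C -> (z == y) || adj y z.
  rewrite !inE /=; set K := y |: neighbours y.
  have clK : closed (@adj H) K.
    apply: intro_closed => // u v uv; rewrite !inE => /orP[/eqP <-|yu].
      by rewrite uv orbT.
    by rewrite (ystar u v yu uv) eqxx.
  move/(closed_connect clK); rewrite !inE => <-.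
  by rewrite [x == y]eq_sym eq_sym.
split; last first.
  apply: (@leq_trans #|y |: neighbours y|).
    by apply: subset_leq_card; apply/subsetP => z /CK; rewrite !inE.
  by rewrite cardsU1; apply: leq_add (leq_b1 _) (deg2 y).
split.
  split; first by apply/card_gt0P; exists (exist _ y yC).
  have cy (u : induced C) : connect (@adj (induced C)) (exist _ y yC) u.
    case: u => u uC; have [/eqP Eu|yu] := orP (CK u uC).
      by apply/eq_connect0/val_inj.
    exact: connect1.
  have csymC : connect_sym (@adj (induced C)).
    by apply: sym_connect_sym; apply: adj_sym.
  by move=> u v; apply: connect_trans (cy v); rewrite csymC.
(* A cycle of length 3 contradicts [nolink] with equal outer vertices, a longer one with four
   consecutive vertices. *)
move=> [|u [|v [|w s]]] // _ /andP[] /=.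
rewrite !inE !negb_or => /and3P[uv vw ws] /and4P[/and3P[nuv nuw nus] /andP[_ nvs] _ _].
case: s ws nus nvs => [|t s].
  rewrite /= andbT => wu _ _; apply: (nolink (val v) (val w) (val u) (val u)) => //.
  by rewrite adj_sym.
rewrite !inE !negb_or rcons_cons => /andP[weight _] _ /andP[nvt _].
apply: (nolink (val v) (val w) (val u) (val t)) => //; first by rewrite adj_sym.
by rewrite eq_sym.
Qed.

Theorem theorem11 (G : sgraph) (cubicG : cubic G) :
  exists V1 V2 : {set G}, weak_bisection 5 V1 V2.
Proof.
have [L mL pairL] := minimal_balanced cubicG.
have cL : cover L by case: mL.
exists [set x | color L x], [set x | ~~ color L x]; split.
  split; last exact: card_color.
    by apply/setP => x; rewrite !inE; case: color.
  by rewrite -setI_eq0; apply/eqP/setP => x; rewrite !inE; case: color.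
move=> S SV.
have [b inS] : exists b, forall x, (x \in S) = (color L x == b).
  by move: SV; rewrite !inE => /orP[]/eqP->; [exists true | exists false] => x;
    rewrite inE; case: color.
have Sb (u : induced S) : color L (val u) = b by apply/eqP; rewrite -inS; apply: valP.
apply: components_tree => [x|u v u' v' uv uu' vv' nu' nv'].
  have [y xy cy] := colorful_neighbour cubicG (val x) mL pairL.
  (* The neighbours inside [S] miss [y], so they form a proper subset of the three neighbours. *)
  rewrite -ltnS -(cubicG (val x)) -(card_imset _ val_inj).
  apply: proper_card; apply/properP; split.
    by apply/subsetP => _ /imsetP[z + ->]; rewrite !inE.
  exists y; first by rewrite inE.
  by apply/imsetP => -[z _ Ey]; rewrite Ey !Sb eqxx in cy.
by apply: (@mono_path_free _ cubicG L (val u) (val v) (val u') (val v'));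
  rewrite ?Sb.
Qed.
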